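(* Let $(X,d)$ be a compact metric space, let $G$ be the free semigroup with generators $f_0,\ldots,f_{m-1}$, continuous maps of $X$ to itself, and let $\Phi=\{\varphi_0,\ldots,\varphi_{m-1}\}\subset C(X,\mathbb{R})$. Let $\mu$ be a Borel probability measure on $X$, $Z$ a Borel subset of $X$ and $s\in(0,\infty)$. For $x\in X$ put $$\underline{P}(G,\Phi,x)=\lim_{r\to0}\liminf_{n\to\infty}-\frac1n\max_{|w|=n}\{\log\mu(B_w(x,r))-S_w\Phi(x)\},$$ $$\overline{P}(G,\Phi,x)=\lim_{r\to0}\liminf_{n\to\infty}-\frac1n\min_{|w|=n}\{\log\mu(B_w(x,r))-S_w\Phi(x)\},$$ where $w$ ranges over words of length $n$ in $F_m^+$. (1) If $\underline{P}(G,\Phi,x)\ge s$ for all $x\in Z$ and $\mu(Z)>0$, then $P_Z(G,\Phi)\ge s$. (2) If $\overline{P}(G,\Phi,x)\le s$ for all $x\in Z$, then $P_Z(G,\Phi)\le s$.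
   Context: **Words.** $F_m^+$ is the set of finite words in the symbols $0,1,\ldots,m-1$; $|w|$ is the length of $w$; for $w=i_1\cdots i_k$, $\overline{w}=i_k\cdots i_1$. Write $w'\le w$ if $w=w''w'$ for some (possibly empty) word $w''$ (here $w'$ may also be empty); thus $\overline{w'}\le\overline{w}$ means that $w'$ is an initial segment of $w$. For $w=i_1\cdots i_n$ put $f_w=f_{i_1}\circ\cdots\circ f_{i_n}$, with $f_w=\mathrm{id}$ for the empty word. **Birkhoff sums and Bowen balls.** For $w=i_1\cdots i_n$, $S_w\Phi(x)=\varphi_{i_1}(x)+\varphi_{i_2}(f_{i_1}(x))+\cdots+\varphi_{i_n}(f_{i_{n-1}}\circ\cdots\circ f_{i_1}(x))$. For $\delta>0$ the $(w,\delta)$-Bowen ball at $x$ is $B_w(x,\delta)=\{y\in X:d(f_{w'}(x),f_{w'}(y))\le\delta\text{ for all }w'\le\overline{w}\}$. **Topological pressure.** Let $\mathcal{U}$ be a finite open cover of $X$. A string is $\mathbf{U}=(U_0,\ldots,U_n)\in\mathcal{U}^{n+1}$, $n\ge0$, of length $m(\mathbf{U})=n+1$. For a word $w=i_1\cdots i_n$ with $n=m(\mathbf{U})-1$ let $$X_w(\mathbf{U})=\{x\in X: x\in U_0,\ f_{i_j}\circ\cdots\circ f_{i_1}(x)\in U_j,\ j=1,\ldots,n\}.$$ For $Z\subset X$, $\alpha\in\mathbb{R}$ and a word $w$ with $|w|=N$, let $$M_w(Z,\alpha,\Phi,\mathcal{U},N)=\inf_{\mathcal{G}_w}\sum_{\mathbf{U}\in\mathcal{G}_w}\exp\Big(-\alpha\,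 m(\mathbf{U})+\sup_{x\in X_{w_{\mathbf{U}}}(\mathbf{U})}S_{w_{\mathbf{U}}}\Phi(x)\Big),$$ where the infimum is over finite or countable families $\mathcal{G}_w$ of strings, each $\mathbf{U}\in\mathcal{G}_w$ having $m(\mathbf{U})\ge N+1$ and carrying a word $w_{\mathbf{U}}$ with $|w_{\mathbf{U}}|=m(\mathbf{U})-1$ and $\overline{w}\le\overline{w_{\mathbf{U}}}$, such that $\bigcup_{\mathbf{U}\in\mathcal{G}_w}X_{w_{\mathbf{U}}}(\mathbf{U})\supset Z$ (with $\sup\emptyset=-\infty$, $\exp(-\infty)=0$). Put $M(Z,\alpha,\Phi,\mathcal{U},N)=\frac{1}{m^N}\sum_{|w|=N}M_w(Z,\alpha,\Phi,\mathcal{U},N)$, which is non-decreasing in $N$, and $m(Z,\alpha,\Phi,\mathcal{U})=\lim_{N\to\infty}M(Z,\alpha,\Phi,\mathcal{U},N)$. Let $P_Z(G,\Phi,\mathcal{U})=\inf\{\alpha:m(Z,\alpha,\Phi,\mathcal{U})=0\}=\sup\{\alpha:m(Z,\alpha,\Phi,\mathcal{U})=\infty\}$ and $$P_Z(G,\Phi)=\lim_{|\mathcal{U}|\to0}P_Z(G,\Phi,\mathcal{U}),$$ the limit (which exists) being over finite open covers with maximal diameter $|\mathcal{U}|$ tending to $0$. *)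

(* Defs.v *)
From HB Require Import structures.
From mathcomp Require Import all_boot all_order all_algebra.
From mathcomp Require Import all_classical all_reals all_analysis.

Set Implicit Arguments.
Unset Strict Implicit.
Unset Printing Implicit Defensive.

Import Order.TTheory GRing.Theory Num.Theory.
Import numFieldNormedType.Exports.

Local Open Scope classical_set_scope.
Local Open Scope ring_scope.

(* The base point is only there because [measurableType] requires one; a space
   carrying a probability measure is nonempty anyway. *)
#[short(type="pmetricType")]
HB.structure Definition PointedMetric (K : numDomainType) :=
  {M of Metric K M & Pointed M}.

Notation borelType X := (g_sigma_algebraType (@open X)).

Section words.
Context {m : nat} {T : Type}.
Implicit Types (f : 'I_m -> T -> T) (w : seq 'I_m).

(* [suffix w' w], i.e. w = w'' w', is the relation w' <= w on words. *)

Definition word_map f w : T -> T := foldr (fun i g => f i \o g) idfun w.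

Fixpoint birkhoff {R : realType} f (phi : 'I_m -> T -> R) w (x : T) : R :=
  if w is i :: w' then phi i x + birkhoff f phi w' (f i x) else 0.

(* For j <= size w, [word_map f (rev (take j w))] is f_{i_j} o ... o f_{i_1}. *)
Definition string_set f (U : seq (set T)) w : set T :=
  [set x | forall j, (j <= size w)%N ->
     nth set0 U j (word_map f (rev (take j w)) x)].

End words.

Section pressure.
Context {R : realType} {X : metricType R} {m : nat}.
Variables (f : 'I_m -> X -> X) (phi : 'I_m -> X -> R).
Implicit Types (cov : set (set X)) (w : seq 'I_m) (Z : set X).

Local Open Scope ereal_scope.

Definition bowen_ball w (x : X) (r : R) : set X :=
  [set y | forall w', suffix w' (rev w) ->
     (mdist (word_map f w' x) (word_map f w' y) <= r)%R].

Definition finite_open_cover cov : Prop :=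
  [/\ finite_set cov, (forall A, cov A -> open A) &
      \bigcup_(A in cov) A = [set: X]].

Definition diam (A : set X) : \bar R :=
  ereal_sup [set (mdist x y)%:E | x in A & y in A].

Definition mesh cov : \bar R := ereal_sup (diam @` cov).

(* A member [p] of a family stands for a string U = p.1 together with the word
   w_U = p.2 it carries, so one string may occur with several words. *)
Definition admissible cov Z w (N : nat)
    (G : set (seq (set X) * seq 'I_m)) : Prop :=
  [/\ countable G,
      (forall p, G p -> [/\ (forall A, A \in p.1 -> cov A),
                            (N.+1 <= size p.1)%N,
                            size p.1 = (size p.2).+1 &
                            suffix (rev w) (rev p.2)]) &
      Z `<=` \bigcup_(p in G) string_set f p.1 p.2].

Definition pressure_Mw Z (a : R) cov (N : nat) w : \bar R :=
  ereal_inf [set \esum_(p in G)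
      expeR ((- (a * (size p.1)%:R))%:E +
             ereal_sup [set (birkhoff f phi p.2 x)%:E
                       | x in string_set f p.1 p.2])
    | G in admissible cov Z w N].

Definition pressure_M Z (a : R) cov (N : nat) : \bar R :=
  ((m%:R ^+ N)^-1)%:E * \sum_(w : N.-tuple 'I_m) pressure_Mw Z a cov N w.

Definition pressure_m Z (a : R) cov : \bar R :=
  limn (fun N => pressure_M Z a cov N).

Definition cover_pressure Z cov : \bar R :=
  ereal_inf [set a%:E | a in [set a : R | pressure_m Z a cov = 0]].

Definition fine_covers : set_system (set (set X)) :=
  filter_from [set e : R | (0 < e)%R]
    (fun e => [set cov | finite_open_cover cov /\ mesh cov < e%:E]).

Definition top_pressure Z : \bar R :=
  lim (cover_pressure Z cov @[cov --> fine_covers]).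

End pressure.

Section local_pressure.
Context {R : realType} {X : pmetricType R} {m : nat}.
Variables (mu : probability (borelType X) R).
Variables (f : 'I_m -> X -> X) (phi : 'I_m -> X -> R).

Local Open Scope ereal_scope.

Definition local_term (r : R) (x : X) (w : seq 'I_m) : \bar R :=
  lne (mu (bowen_ball f w x r)) - (birkhoff f phi w x)%:E.

Definition lower_local_pressure (x : X) : \bar R :=
  lim (limn_einf (fun n => (- n%:R^-1)%:E *
         \big[maxe/-oo]_(w : n.-tuple 'I_m) local_term r x w)
       @[r --> 0%R^'+]).

Definition upper_local_pressure (x : X) : \bar R :=
  lim (limn_einf (fun n => (- n%:R^-1)%:E *
         \big[mine/+oo]_(w : n.-tuple 'I_m) local_term r x w)
       @[r --> 0%R^'+]).

End local_pressure.

(* Main.v *)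
Require Import Defs.
From HB Require Import structures.
From mathcomp Require Import all_boot all_order all_algebra.
From mathcomp Require Import finmap lra.
From mathcomp Require Import all_classical all_reals all_analysis.
Set Implicit Arguments.
Unset Strict Implicit.
Unset Printing Implicit Defensive.
Import Order.TTheory GRing.Theory Num.Theory.
Import numFieldNormedType.Exports.
Local Open Scope classical_set_scope.
Local Open Scope ring_scope.
Local Open Scope ereal_scope.

(** Strings and Bowen balls are interchangeable up to scale: if the members of a
    cover have diameter less than [r], a string set lies in the Bowen ball of
    radius [r] about each of its points, and if [r] is at most a Lebesgue number
    of the cover, a Bowen ball of radius [r] lies in a string set.  The theorem
    then compares weights of strings with measures of Bowen balls.

    Part (1) is a mass distribution argument.  For [c < s] the hypothesis bounds
    [mu (B_w(x, r))] by [exp (S_w phi x - c * |w|)] for all long words [w], with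
    [r] and the length depending on [x] only through countably many choices, so
    on a non-negligible part [A] of [Z] they can be fixed
    ([exists_uniform_nonnegligible]).  If [m(Z, a) = 0] for a cover of mesh less
    than [r] and some [a < c], strings of arbitrarily small total weight cover
    [A], and so do Bowen balls of arbitrarily small total measure, which
    contradicts the choice of [A] ([negligible_of_pressure_m_eq0]).

    Part (2) is a packing argument.  For [c > s] and every [r], each [x] in [Z]
    satisfies [mu (B_w(x, r)) >= exp (S_w phi x - c * n)] for infinitely many
    [n] and all [w] of length [n].  Maximal disjoint families of such balls have
    total measure at most [1], and the balls of twice the radius cover.
    Choosing for each [n] one word that extends a given word of length [N] gives
    a family admissible for that word whose total weight is a geometric tail in
    [N], uniformly in the word ([pressure_Mw_le_geometric]).

    The topological pressure is a limit over fine covers, and its lower bound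
    requires this limit to exist.  It does because passing from a cover to a
    finer one lowers the pressure by at most the oscillation of the potentials
    on the members of the first ([cover_pressure_refine],
    [is_cvg_cover_pressure]). *)

(** * Extended reals, sums over arbitrary index sets, measures *)

Lemma cvge_sandwich (R : realType) (T : Type) (F : set_system T) (FF : Filter F)
    (u : T -> \bar R) (l : \bar R) :
  (forall a, a < l -> \forall t \near F, a < u t) ->
  (forall b, l < b -> \forall t \near F, u t < b) ->
  u @ F --> l.
Proof.
case: l => [l lu ul|lu _|_ ul]; last 2 first.
- by apply/cvgeyPgt => A; apply: lu; rewrite ltry.
- by apply/cvgeNyPlt => A; apply: ul; rewrite ltNyr.
apply/fine_cvgP; split.
  near=> t; rewrite fin_real//; apply/andP; split; near: t.
    by apply: filterS (lu (l - 1)%:E _) => [t|]; [exact: lt_trans (ltNyr _)|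
      rewrite lte_fin ltrBlDr ltrDl].
  by apply: filterS (ul (l + 1)%:E _) => [t /lt_trans|];
    [apply; rewrite ltry|rewrite lte_fin ltrDl].
apply/cvgrPdist_lt => e e0; near=> t.
have lt1 : (l - e)%:E < u t.
  by near: t; apply: lu; rewrite lte_fin ltrBlDr ltrDl.
have lt2 : u t < (l + e)%:E by near: t; apply: ul; rewrite lte_fin ltrDl.
move: lt1 lt2; rewrite /=; case: (u t) => [r| |]//=; rewrite !lte_fin => h1 h2.
by rewrite distrC ltr_norml ltrBlDl h2 andbT ltrBrDl.
Unshelve. all: by end_near. Qed.

Section liminf.
Context {R : realType}.
Implicit Types (u v : (\bar R)^nat) (c : \bar R).

Lemma lt_limn_einf u c : c < limn_einf u ->
  exists N, forall n, (N <= n)%N -> c < u n.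
Proof.
rewrite limn_einf_lim (cvg_lim _ (@cvg_einfs_sup _ u))//.
move=> /ereal_sup_gt[_ [N _ <-] cN]; exists N => n Nn.
by apply: lt_le_trans cN _; apply: ereal_inf_lbound; exists n.
Qed.

Lemma limn_einf_lt u c : limn_einf u < c ->
  forall N, exists2 n, (N <= n)%N & u n < c.
Proof.
move=> uc N; have : einfs u N < c.
  apply: le_lt_trans uc.
  rewrite limn_einf_lim (cvg_lim _ (@cvg_einfs_sup _ u))//.
  by apply: ereal_sup_ubound; exists N.
by move=> /ereal_inf_lt[_ [n /= Nn <-] unc]; exists n.
Qed.

Lemma le_limn_einf u v : (forall n, u n <= v n) -> limn_einf u <= limn_einf v.
Proof.
move=> uv; rewrite !limn_einf_lim.
apply: lee_lim; [exact: is_cvg_einfs|exact: is_cvg_einfs|].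
apply: nearW => N; apply: le_ereal_inf_tmp => _ [n Nn <-].
by apply: ge_ereal_inf; exists (u n); [exists n|exact: uv].
Qed.

End liminf.

Lemma invr_archi_bound_le (R : archiRealFieldType) (r : R) (k : nat) :
  (0 < r)%R -> (Num.Def.archi_bound r^-1 <= k)%N -> (k.+1%:R^-1 <= r)%R.
Proof.
move=> r0 rk; rewrite -[leRHS]invrK lef_pV2 ?posrE ?invr_gt0//.
apply: le_trans (ltW (archi_boundP _)) _; first by rewrite invr_ge0 ltW.
by rewrite ler_nat (leq_trans rk).
Qed.

Lemma esum_subset (R : realType) (T : choiceType) (P Q : set T)
    (a : T -> \bar R) :
  P `<=` Q -> \esum_(p in P) a p <= \esum_(p in Q) a p.
Proof.
move=> PQ; apply: ereal_sup_le => _ [A [Afin AP] <-].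
by exists A => //; split=> //; exact: subset_trans PQ.
Qed.

(** A section of [e] over the image embeds the left sum into the right one;
    [e] may identify indices, as when different centres carry one string. *)
Lemma esum_image_le (R : realType) (T T' : choiceType) (P : set T)
    (e : T -> T') (a : T' -> \bar R) :
  \esum_(q in e @` P) a q <= \esum_(p in P) a (e p).
Proof.
have [->|/set0P[p0 _]] := eqVneq P set0; first by rewrite image_set0 !esum_set0.
have /choice[g gP] : forall q, exists p, (e @` P) q -> P p /\ e p = q.
  by move=> q; case: (pselect ((e @` P) q)) => [[p]|nq]; [exists p|exists p0].
have ginj : set_inj (e @` P) g.
  move=> x y /[!inE] /gP[_ ex] /gP[_ ey] gxy.
  by rewrite -ex -ey gxy.
rewrite (_ : \esum_(q in e @` P) a q = \esum_(q in e @` P) a (e (g q))).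
  rewrite -(esum_image (e @` P) g (a \o e)) //.
  by apply: esum_subset => _ [q /gP[Pg _] <-].
by apply: eq_esum => q /gP[_ ->].
Qed.

Lemma esumZl_le (R : realType) (T : choiceType) (P : set T) (c : R)
    (a : T -> \bar R) : (0 <= c)%R -> (forall p, 0 <= a p) ->
  \esum_(p in P) (c%:E * a p) <= c%:E * \esum_(p in P) a p.
Proof.
move=> c0 a0; apply: ge_ereal_sup => _ [A [Afin AP] <-].
rewrite -ge0_mule_fsumr//.
apply: lee_wpmul2l; first by rewrite lee_fin.
by apply: ereal_sup_ubound; exists A.
Qed.

(** A convergent sum has only finitely many terms above each [1 / (k + 1)]. *)
Lemma countable_esum_gt0 (R : realType) (T : choiceType) (D : set T)
    (a : T -> \bar R) :
  (forall x, D x -> 0 < a x) -> \esum_(x in D) a x < +oo -> countable D.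
Proof.
move=> a0 sum_fin.
pose D_ k := [set x | D x /\ (k.+1%:R^-1)%:E <= a x].
have -> : D = \bigcup_k D_ k.
  apply/seteqP; split => [x Dx|x [k _ []]]//.
  have [k kx] : exists k, (k.+1%:R^-1)%:E <= a x.
    have := a0 _ Dx; case: (a x) => [r| |]//; last by exists 0%N; rewrite leey.
    rewrite lte_fin => r0; exists (Num.Def.archi_bound r^-1).
    by rewrite lee_fin invr_archi_bound_le.
  by exists k.
apply: bigcup_countable => // k _; apply: finite_set_countable.
apply: contrapT => Dinf.
have sum_ge0 : 0 <= \esum_(x in D) a x by apply: esum_ge0 => x /a0/ltW.
have [M sumE] : exists M : R, \esum_(x in D) a x = M%:E.
  by case: (\esum_(x in D) a x) sum_fin sum_ge0 => [r| |]// _ _; exists r.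
have M0 : (0 <= M)%R by rewrite -lee_fin -sumE.
have [B BD Bsize] := infinite_set_fset
  (Num.Def.archi_bound (M * k.+1%:R)) Dinf.
have : \sum_(x \in [set` B]) a x <= M%:E.
  rewrite -sumE; apply: ereal_sup_ubound; exists [set` B] => //.
  by split=> // x /BD[].
apply/negP; rewrite -ltNge.
apply: (@lt_le_trans _ _ (\sum_(x \in [set` B]) (k.+1%:R^-1)%:E)); last first.
  by apply: lee_fsum => // x /BD[].
rewrite fsbig_finite//= set_fsetK sumEFin big_const_seq count_predT iter_addr.
rewrite addr0 lte_fin -[ltRHS]mulr_natl ltr_pdivlMr//.
apply: lt_le_trans (archi_boundP _) _; first by rewrite mulr_ge0.
by rewrite ler_nat.
Qed.

(** Subadditivity over sequences transfers to any countable index set: an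
    injection into [nat] enumerates it, with empty sets filling the gaps. *)
Lemma measure_countable_bigcup_le d (T : measurableType d) (R : realType)
    (mu : {measure set T -> \bar R}) (I : choiceType) (G : set I)
    (B : I -> set T) :
  countable G -> (forall i, measurable (B i)) ->
  measurable (\bigcup_(i in G) B i) /\
  mu (\bigcup_(i in G) B i) <= \esum_(i in G) mu (B i).
Proof.
move=> /[dup] Gc /countable_injP[g ginj] mB.
have [->|/set0P[i0 Gi0]] := eqVneq G set0.
  by rewrite bigcup_set0 measure0 esum_set0; split.
have /choice[h hP] : forall n, exists i, (g @` G) n -> G i /\ g i = n.
  by move=> n; case: (pselect ((g @` G) n)) => [[p]|nq]; [exists p|exists i0].
have hg i : G i -> h (g i) = i.
  move=> Gi; have [] := hP (g i); first by exists i.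
  by move=> Ghi /ginj; apply; rewrite inE.
pose F n := if n \in g @` G then B (h n) else set0.
have mF n : measurable (F n) by rewrite /F; case: ifP.
have -> : \bigcup_(i in G) B i = \bigcup_n F n.
  apply/seteqP; split=> x [i Gi Bx].
    by exists (g i) => //; rewrite /F mem_set ?hg//; exists i.
  move: Bx; rewrite /F; case: ifPn => //; rewrite inE => /hP[Gh _] Bx.
  by exists (h i).
have mFU : measurable (\bigcup_n F n) by exact: bigcup_measurable.
split=> //.
have /le_trans : mu (\bigcup_n F n) <= \sum_(0 <= n <oo) mu (F n).
  exact: measure_sigma_subadditive.
apply.
rewrite nneseries_esumT//.
rewrite (_ : \esum_(i in setT) _ = \esum_(n in g @` G) mu (B (h n))).
  rewrite esum_image//.
  rewrite (@eq_esum _ _ _ (fun i => mu (B (h (g i)))) (fun i => mu (B i)))//.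
  by move=> i /hg ->.
rewrite [RHS]esum_mkcond; apply: eq_esum => n _; rewrite /F.
by case: ifP => //; rewrite measure0.
Qed.

(** Intersecting the covers obtained for [e = 1 / (k + 1)] gives a measurable
    null set, even if [A] is not measurable. *)
Lemma negligible_le_eps d (T : measurableType d) (R : realType)
    (mu : {measure set T -> \bar R}) (A : set T) :
  (forall e : R, (0 < e)%R ->
    exists B, [/\ measurable B, A `<=` B & mu B <= e%:E]) ->
  mu.-negligible A.
Proof.
move=> small; have k0 (k : nat) : (0 < k.+1%:R^-1 :> R)%R.
  by rewrite invr_gt0 ltr0n.
have /choice[B BP] := fun k => small _ (k0 k).
have mB : measurable (\bigcap_k B k).
  by apply: bigcap_measurable => [|k _]; [exists 0%N|have [] := BP k].
exists (\bigcap_k B k); split => //; last first.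
  by move=> x Ax k _; have [_ AB _] := BP k; exact: AB.
apply/eqP; rewrite eq_le measure_ge0 andbT; apply/lee_addgt0Pr => e e0.
rewrite add0e; have [mBk _ Bk] := BP (Num.Def.archi_bound e^-1).
apply: le_trans (le_trans _ Bk) _.
  by apply: le_measure; rewrite ?inE//; apply: bigcap_inf.
by rewrite lee_fin invr_archi_bound_le.
Qed.

Lemma esum_disjoint_le1 d (T : measurableType d) (R : realType)
    (mu : probability T R) (I : choiceType) (D : set I) (B : I -> set T) :
  (forall i, measurable (B i)) -> trivIset D B ->
  \esum_(i in D) mu (B i) <= 1.
Proof.
move=> mB tB; apply: ge_ereal_sup => _ [A [Afin AD] <-].
rewrite -measure_fin_bigcup//; last exact: sub_trivIset tB.
by apply: probability_le1; exact: fin_bigcup_measurable.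
Qed.

Lemma esum_geometric_le (R : realType) (C q : R) :
  (0 <= C)%R -> (0 < q < 1)%R ->
  \esum_(k in [set: nat]) (C * q ^+ k)%:E <= (C / (1 - q))%:E.
Proof.
move=> C0 /andP[q0 q1].
have Cq0 k : 0 <= (C * q ^+ k)%:E by rewrite lee_fin mulr_ge0// exprn_ge0// ltW.
rewrite -nneseries_esumT//; apply: lime_le; first exact: is_cvg_nneseries.
apply: nearW => n; rewrite sumEFin lee_fin.
by apply: geometric_le_lim => //; rewrite ger0_norm// ltW.
Qed.

(** * Compactness and fine covers *)

Section compact_metric.
Context {R : realType} {X : pmetricType R}.
Hypothesis X_compact : compact [set: X].

(** Compactness in the form used below: a monotone property that holds near
    each point at some scale holds everywhere at one scale.  Lebesgue numbers
    and uniform continuity are both instances. *)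
Lemma compact_uniform_radius (P : R -> X -> Prop) :
  (forall r r' x, (r <= r')%R -> P r' x -> P r x) ->
  (forall x, exists2 e, (0 < e)%R & forall y, (mdist x y < e)%R -> P e y) ->
  exists2 r, (0 < r)%R & forall x, P r x.
Proof.
move=> Pmono Ploc.
have near_cov : forall x, [set: X] x ->
    \forall x' \near x & r \near (0 : R)^'+, P r x'.
  move=> x _; have [e e0 Pe] := Ploc x.
  exists (ball x e, [set r | (r < e)%R]); first split.
  - exact: nbhsx_ballx.
  - exact: nbhs_right_lt.
  - move=> [y r]/= [xy re]; apply: Pmono (ltW re) (Pe _ _).
    by move: xy; rewrite ballEmdist.
have /compact_near_coveringP/(_ _ _ P _ near_cov) Pnear := X_compact.
near (0 : R)^'+ => r; exists r; first by [].
have : [set: X] `<=` P r by near: r.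
by move=> h x; exact: h.
Unshelve. all: by end_near. Qed.

Lemma lebesgue_number (cov : set (set X)) : finite_open_cover cov ->
  exists2 r, (0 < r)%R &
    forall x, exists2 U, cov U & forall y, (mdist x y <= r)%R -> U y.
Proof.
move=> [_ cov_open cov_cover].
apply: (compact_uniform_radius (P := fun r x =>
  exists2 U, cov U & forall y, (mdist x y <= r)%R -> U y)).
  move=> r r' x rr' [U cU xU]; exists U => // y /le_trans xy.
  exact: xU (xy _ rr').
move=> x.
have [U cU Ux] : (\bigcup_(A in cov) A) x by rewrite cov_cover.
have /nbhs_ballP[e /= e0 eU] : nbhs x U.
  by apply: open_nbhs_nbhs; split => //; exact: cov_open.
exists (e / 2)%R; first by rewrite divr_gt0.
move=> y xy; exists U => // z yz; apply: eU; rewrite ballEmdist/=.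
by rewrite (splitr e); apply: le_lt_trans (metric_triangle _ y _) (ltr_leD _ _).
Qed.

Lemma uniform_modulus (m : nat) (phi : 'I_m -> X -> R) (e : R) :
  (forall i, continuous (phi i)) -> (0 < e)%R ->
  exists2 d, (0 < d)%R &
    forall x y, (mdist x y < d)%R -> forall i, (phi i x <= phi i y + e)%R.
Proof.
move=> phi_cont e0.
apply: (compact_uniform_radius (P := fun r x => forall y,
  (mdist x y < r)%R -> forall i, (phi i x <= phi i y + e)%R)).
  by move=> r r' x rr' Pr' y xy; exact: Pr' (lt_le_trans xy rr').
move=> x.
have : \forall y \near x, forall i, (`|phi i x - phi i y| < e / 2)%R.
  apply: filter_forall => i.
  by have /cvgrPdist_lt := phi_cont i x; apply; rewrite divr_gt0.
move=> /nbhs_ballP[d /= d0 dP].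
exists (d / 2)%R; first by rewrite divr_gt0.
move=> y xy z yz i.
have yball : ball x d y.
  rewrite ballEmdist/= (lt_le_trans xy)// ler_pdivrMr//.
  by rewrite ler_peMr ?ler1n// ltW.
have zball : ball x d z.
  rewrite ballEmdist/= (splitr d).
  exact: le_lt_trans (metric_triangle _ y _) (ltrD _ _).
have := dP _ yball i; have := dP _ zball i; rewrite !ltr_norml.
move=> /andP[_ xz] /andP[yx _]; lra.
Qed.

(** This makes [fine_covers] a proper filter, so that limits along it are
    unique. *)
Lemma fine_cover_exists (e : R) : (0 < e)%R ->
  exists cov : set (set X), finite_open_cover cov /\ mesh cov < e%:E.
Proof.
move=> e0; have e4 : (0 < e / 4)%R by rewrite divr_gt0.
have := X_compact; rewrite compact_cover.
move=> /(_ X setT (fun x => (ball x (e / 4))^°)).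
case=> [x _|x _|D _ DX]; first exact: open_interior.
  by exists x => //; exact: nbhsx_ballx.
exists ((fun x => (ball x (e / 4))^°) @` [set` D]); split.
  split.
  - by apply: finite_image; exact: finite_fset.
  - by move=> _ [x _ <-]; exact: open_interior.
  - apply/seteqP; split=> // x /DX[y Dy yx].
    by exists (ball y (e / 4))^° => //; exists y.
apply: (@le_lt_trans _ _ (e / 2)%:E); last first.
  by rewrite lte_fin ltr_pdivrMr// ltr_pMr// ltr1n.
apply: ge_ereal_sup => _ [_ [x _ <-] <-].
apply: ge_ereal_sup => _ [y /interior_subset xy] [z /interior_subset xz] <-.
move: xy xz; rewrite ballEmdist/= => xy xz; rewrite lee_fin.
apply: le_trans (metric_triangle _ x _) _; rewrite metric_sym; lra.
Qed.

End compact_metric.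

Section fine_covers.
Context {R : realType} {X : pmetricType R}.

Lemma mesh_lt (cov : set (set X)) (e : R) : mesh cov < e%:E ->
  forall A x y, cov A -> A x -> A y -> (mdist x y < e)%R.
Proof.
move=> mesh_e A x y cA Ax Ay; rewrite -lte_fin; apply: le_lt_trans mesh_e.
apply: le_ereal_sup_tmp; exists (diam A); first by exists A.
by apply: ereal_sup_ubound; exists x => //; exists y.
Qed.

Lemma near_fine_covers (e : R) : (0 < e)%R ->
  \forall cov \near @fine_covers R X, finite_open_cover cov /\
    forall A x y, cov A -> A x -> A y -> (mdist x y < e)%R.
Proof.
by move=> e0; exists e => // cov [covP mesh_e]; split => //; exact: mesh_lt.
Qed.

Lemma fine_covers_proper : compact [set: X] -> ProperFilter (@fine_covers R X).
Proof.
move=> X_compact; apply: Build_ProperFilter; last first.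
  apply: filter_from_filter; first by exists 1%R => /=.
  move=> e e' /= e0 e'0; exists (Num.min e e'); first by rewrite /= lt_min e0.
  by move=> cov [covP]; rewrite EFin_min lt_min => /andP[].
move=> [e /= e0 eP]; have [cov covP] := fine_cover_exists X_compact e0.
exact: (eP cov).
Qed.

End fine_covers.

(** * Words, Birkhoff sums and Bowen balls *)

Section words.
Context {R : realType} {X : pmetricType R} {m : nat}.
Variable f : 'I_m -> X -> X.
Implicit Types (w : seq 'I_m) (x y : X).

(** The point reached after the first [j] letters of [w]; string sets and Bowen
    balls are both conditions on the points [itinerary w j x], [j <= size w]. *)
Definition itinerary w j : X -> X := word_map f (rev (take j w)).

Lemma itinerary0 w x : itinerary w 0 x = x.
Proof. by rewrite /itinerary take0. Qed.

Lemma itinerary_cons i w j x :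
  itinerary (i :: w) j.+1 x = itinerary w j (f i x).
Proof.
rewrite /itinerary /= rev_cons /word_map foldr_rcons.
by elim: (rev _) => //= k s ->.
Qed.

Lemma birkhoff_le_dist (phi : 'I_m -> X -> R) (g : R) w x y :
  (forall j, (j < size w)%N -> forall i,
    (phi i (itinerary w j x) <= phi i (itinerary w j y) + g)%R) ->
  (birkhoff f phi w x <= birkhoff f phi w y + g * (size w)%:R)%R.
Proof.
elim: w x y => [x y _|i w IH x y xy]; first by rewrite /= mulr0 addr0.
have := xy 0%N isT i; rewrite !itinerary0 => xy0.
have := IH (f i x) (f i y); rewrite /= -natr1 => {}IH.
have {}IH : (birkhoff f phi w (f i x) <=
             birkhoff f phi w (f i y) + g * (size w)%:R)%R.
  by apply: IH => j jw k; rewrite -!itinerary_cons; exact: xy.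
rewrite mulrDr mulr1; lra.
Qed.

Lemma bowen_ballP w x r y : bowen_ball f w x r y <->
  forall j, (j <= size w)%N ->
    (mdist (itinerary w j x) (itinerary w j y) <= r)%R.
Proof.
split=> [B j jw|B w' w'w]; first by apply: B; rewrite suffix_rev prefix_take.
have := w'w; rewrite -[w']revK suffix_rev prefixE => /eqP <-.
by apply: B; rewrite size_rev -(size_rev w); exact: size_suffix.
Qed.

Lemma bowen_ball_center w x r : (0 <= r)%R -> bowen_ball f w x r x.
Proof. by move=> r0; apply/bowen_ballP => j _; rewrite mdistxx. Qed.

Lemma subset_bowen_ball w x r r' : (r <= r')%R ->
  bowen_ball f w x r `<=` bowen_ball f w x r'.
Proof. by move=> rr' y B w' /B/le_trans; apply. Qed.

Hypothesis f_cont : forall i, continuous (f i).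

Lemma continuous_word_map w : continuous (word_map f w).
Proof.
elim: w => [|i w IH] x; first exact: cvg_id.
by apply: continuous_comp; [exact: IH|exact: f_cont].
Qed.

Lemma closed_bowen_ball w x r : closed (bowen_ball f w x r).
Proof.
have -> : bowen_ball f w x r = \bigcap_(w' in [set w' | suffix w' (rev w)])
    word_map f w' @^-1` [set z | (mdist (word_map f w' x) z <= r)%R].
  by apply/seteqP; split.
apply: closed_bigI => w' _; apply: preimage_closed.
  by move=> y _; exact: continuous_word_map.
rewrite -openC; set a := word_map f w' x; rewrite openE => z /= /negP.
rewrite -ltNge => az; apply/nbhs_ballP; exists (mdist a z - r)%R => /=.
  by rewrite subr_gt0.
move=> y; rewrite ballEmdist/= => zy; apply/negP; rewrite -ltNge.
have := metric_triangle a y z; rewrite (metric_sym y); lra.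
Qed.

(** Bowen balls are defined with a non-strict inequality, hence closed. *)
Lemma measurable_bowen_ball w x r :
  measurable (bowen_ball f w x r : set (borelType X)).
Proof.
rewrite -[bowen_ball _ _ _ _]setCK; apply: measurableC.
by apply: sub_sigma_algebra; exact/closed_openC/closed_bowen_ball.
Qed.

End words.

(** * Pressure of a cover and its limit *)

Section pressure_theory.
Context {R : realType} {X : pmetricType R} {m : nat}.
Variables (f : 'I_m -> X -> X) (phi : 'I_m -> X -> R).
Hypothesis m_gt0 : (0 < m)%N.
Implicit Types (cov : set (set X)) (w : seq 'I_m) (Z : set X).
Implicit Types (p : seq (set X) * seq 'I_m).

Definition birkhoff_sup p : \bar R :=
  ereal_sup [set (birkhoff f phi p.2 x)%:E | x in string_set f p.1 p.2].

Definition string_weight (a : R) p : \bar R :=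
  expeR ((- (a * (size p.1)%:R))%:E + birkhoff_sup p).

Definition oscillation_le cov (g : R) : Prop :=
  forall A x y, cov A -> A x -> A y -> forall i, (phi i x <= phi i y + g)%R.

Lemma pressure_Mw_le_esum Z a cov N w G : admissible f cov Z w N G ->
  pressure_Mw f phi Z a cov N w <= \esum_(p in G) string_weight a p.
Proof. by move=> Gadm; apply: ereal_inf_lbound; exists G. Qed.

Lemma pressure_Mw_lt Z a cov N w y : pressure_Mw f phi Z a cov N w < y ->
  exists2 G, admissible f cov Z w N G & \esum_(p in G) string_weight a p < y.
Proof. by move=> /ereal_inf_lt[_ [G Gadm <-] Gy]; exists G. Qed.

Lemma pressure_Mw_ge0 Z a cov N w : 0 <= pressure_Mw f phi Z a cov N w.
Proof.
apply: le_ereal_inf_tmp => _ [G _ <-].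
by apply: esum_ge0 => p _; exact: expeR_ge0.
Qed.

(** A family whose words all extend [rcons w i] is also admissible for [w], so
    the infimum for [w] is over a larger class. *)
Lemma pressure_Mw_rcons Z a cov N w i :
  pressure_Mw f phi Z a cov N w <= pressure_Mw f phi Z a cov N.+1 (rcons w i).
Proof.
apply: ereal_inf_le_tmp => _ [G [Gc GP GZ] <-]; exists G => //; split=> // p.
move=> /GP[pcov psize pw wp]; split => //; first exact: ltnW.
apply: suffix_trans wp; rewrite suffix_rev.
by rewrite -cats1 prefix_prefix.
Qed.

Lemma sum_tuple_rcons N (F : seq 'I_m -> \bar R) :
  \sum_(w : N.+1.-tuple 'I_m) F w =
  \sum_(w : N.-tuple 'I_m) \sum_(i < m) F (rcons w i).
Proof.
rewrite pair_big/= (reindex (fun p : N.-tuple 'I_m * 'I_m =>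
  [tuple of rcons p.1 p.2])) //.
apply: onW_bij; apply: inj_card_bij.
  move=> [w i] [w' i'] /(congr1 val)/= /rcons_inj[ww' ->].
  by congr (_, _); exact: val_inj.
by rewrite card_prod !card_tuple card_ord expnSr.
Qed.

(** Averaging [pressure_Mw_rcons] over the [m] letters [i]. *)
Lemma pressure_M_nondecreasing Z a cov :
  nondecreasing_seq (pressure_M f phi Z a cov).
Proof.
apply/nondecreasing_seqP => N; rewrite /pressure_M sum_tuple_rcons.
have m0 : (0 < m%:R :> R)%R by rewrite ltr0n.
apply: (@le_trans _ _ (((m%:R ^+ N.+1)^-1)%:E *
   \sum_(w : N.-tuple 'I_m) (m%:R%:E * pressure_Mw f phi Z a cov N w))).
  rewrite -ge0_sume_distrr; last by move=> w _; exact: pressure_Mw_ge0.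
  by rewrite muleA -EFinM exprSr invfM -mulrA mulVf ?mulr1// gt_eqF.
apply: lee_wpmul2l; first by rewrite lee_fin invr_ge0 exprn_ge0.
apply: lee_sum => w _.
apply: (@le_trans _ _ (\sum_(i < m) pressure_Mw f phi Z a cov N w)).
  by rewrite sumr_const card_ord mule_natl.
by apply: lee_sum => i _; exact: pressure_Mw_rcons.
Qed.

(** By monotonicity in [N] a vanishing limit forces every average, and then
    every nonnegative summand, to vanish. *)
Lemma pressure_m_eq0_Mw Z a cov N (w : N.-tuple 'I_m) :
  pressure_m f phi Z a cov = 0 -> pressure_Mw f phi Z a cov N w = 0.
Proof.
move=> m_eq0; apply/eqP; rewrite eq_le pressure_Mw_ge0 andbT.
have MN : pressure_M f phi Z a cov N <= 0.
  rewrite -m_eq0 /pressure_m.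
  have M_cvg := ereal_nondecreasing_cvgn (pressure_M_nondecreasing Z a cov).
  rewrite (cvg_lim _ M_cvg)//.
  by apply: ereal_sup_ubound; exists N.
rewrite leNgt; apply/negP => Mw_gt0; move: MN; apply/negP; rewrite -ltNge.
rewrite mule_gt0//; first by rewrite lte_fin invr_gt0 exprn_gt0// ltr0n.
rewrite (bigD1 w)//=; apply: lt_le_trans Mw_gt0 _; apply: leeDl.
by apply: sume_ge0 => w' _; exact: pressure_Mw_ge0.
Qed.

(** The bound must be uniform in [w], since [pressure_M] averages over all words
    of length [N]. *)
Lemma pressure_m_eq0 Z a cov (C q : R) : (0 <= C)%R -> (0 <= q < 1)%R ->
  (forall N (w : N.-tuple 'I_m),
    pressure_Mw f phi Z a cov N w <= (C * q ^+ N)%:E) ->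
  pressure_m f phi Z a cov = 0.
Proof.
move=> C0 /andP[q0 q1] Mw_le; rewrite /pressure_m.
apply: cvg_lim => //.
apply: (@squeeze_cvge _ _ _ _ (cst 0) _ (fun N => (C * q ^+ N)%:E)).
- apply: nearW => N; apply/andP; split.
    apply: mule_ge0; first by rewrite lee_fin invr_ge0 exprn_ge0.
    by apply: sume_ge0 => w _; exact: pressure_Mw_ge0.
  have mN0 : (0 < m%:R ^+ N :> R)%R by rewrite exprn_gt0// ltr0n.
  rewrite lee_pdivrMl//.
  apply: (@le_trans _ _ (\sum_(w : N.-tuple 'I_m) (C * q ^+ N)%:E)).
    by apply: lee_sum => w _; exact: Mw_le.
  by rewrite sumr_const card_tuple card_ord -natrX mule_natl.
- exact: cvg_cst.
- apply: cvg_EFin; first exact: nearW.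
  by apply: cvg_geometric; rewrite ger0_norm.
Qed.

Lemma birkhoff_string_le cov (g : R) (U : seq (set X)) w x y :
  oscillation_le cov g ->
  (forall A, A \in U -> cov A) -> size U = (size w).+1 ->
  string_set f U w x -> string_set f U w y ->
  (birkhoff f phi w x <= birkhoff f phi w y + g * (size w)%:R)%R.
Proof.
move=> osc Ucov Usize Ux Uy; apply: birkhoff_le_dist => j jw i.
apply: (osc (nth set0 U j)); last 2 first.
- by apply: Ux; exact: ltnW.
- by apply: Uy; exact: ltnW.
by apply: Ucov; rewrite mem_nth// Usize ltnS ltnW.
Qed.

(** Replace every member of a string over [V] by a member of [cov] containing
    it.  The string set grows, but on the new one Birkhoff sums of length [n]
    vary by at most [g * n], which the shift of [a] by [g] absorbs. *)
Lemma pressure_Mw_refine Z a g cov V N w :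
  (0 <= g)%R -> oscillation_le cov g ->
  (forall A, V A -> exists2 U, cov U & A `<=` U) ->
  pressure_Mw f phi Z (a + g) cov N w <= pressure_Mw f phi Z a V N w.
Proof.
move=> g0 osc /= Vcov.
have /choice[h hP] : forall A, exists U, V A -> cov U /\ A `<=` U.
  move=> A; case: (pselect (V A)) => [/Vcov[U cU AU]|nVA]; first by exists U.
  by exists set0.
apply: le_ereal_inf_tmp => _ [G [Gc GP GZ] <-].
pose e p := (map h p.1, p.2).
(* Empty string sets weigh nothing over [V] but may become nonempty over [cov]:
   they have to be discarded before the replacement. *)
pose G0 := G `&` [set p | string_set f p.1 p.2 !=set0].
have sub_h p : G p -> string_set f p.1 p.2 `<=` string_set f (map h p.1) p.2.
  move=> /GP[pV _ psize _] x xp j jw.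
  have jU : (j < size p.1)%N by rewrite psize ltnS.
  rewrite (nth_map set0)//; have := xp j jw.
  by apply: (hP _ _).2; apply: pV; exact: mem_nth.
have adm : admissible f cov Z w N (e @` G0).
  split.
  - apply: sub_countable (card_image_le _ _) _.
    by apply: sub_countable Gc; apply: subset_card_le => ? [].
  - move=> _ [p [Gp _] <-] /=; have [pV psize pw wp] := GP _ Gp.
    rewrite size_map; split => // _ /mapP[A Ap ->].
    exact: (hP _ (pV _ Ap)).1.
  - move=> x /GZ[p Gp px]; exists (e p); last exact: sub_h.
    by exists p => //; split=> //; exists x.
apply: le_trans (pressure_Mw_le_esum _ adm) _.
apply: le_trans (esum_image_le _ _ _) _.
apply: (@le_trans _ _ (\esum_(p in G0) string_weight a p)); last first.
  by apply: esum_subset => ? [].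
apply: le_esum => p [Gp [y py]]; have [pV _ psize _] := GP _ Gp.
have sup_le : birkhoff_sup (e p) <= birkhoff_sup p + (g * (size p.2)%:R)%:E.
  apply: ge_ereal_sup => _ [x px <-].
  apply: (@le_trans _ _ ((birkhoff f phi p.2 y)%:E + (g * (size p.2)%:R)%:E)).
    rewrite -EFinD lee_fin.
    apply: (birkhoff_string_le osc _ _ px); last exact: sub_h.
      by move=> _ /mapP[A Ap ->]; exact: (hP _ (pV _ Ap)).1.
    by rewrite size_map.
  by apply: leeD2r; apply: ereal_sup_ubound; exists y.
rewrite /string_weight lee_expeR size_map.
apply: le_trans (leeD2l _ sup_le) _.
rewrite addeCA addeC -EFinD leeD2r//= lee_fin psize -natr1; nra.
Qed.

Lemma cover_pressure_refine Z g cov V :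
  (0 <= g)%R -> oscillation_le cov g ->
  (forall A, V A -> exists2 U, cov U & A `<=` U) ->
  cover_pressure f phi Z cov <= cover_pressure f phi Z V + g%:E.
Proof.
move=> g0 osc Vcov; rewrite -leeBlDr//.
apply: le_ereal_inf_tmp => _ [a a_eq0 <-].
rewrite leeBlDr// -EFinD; apply: ereal_inf_lbound; exists (a + g)%R => //=.
apply: (@pressure_m_eq0 _ _ _ 0 0) => //; first by rewrite lexx ltr01.
move=> N w; apply: le_trans (pressure_Mw_refine _ _ _ _ g0 osc Vcov) _.
by rewrite mul0r (pressure_m_eq0_Mw w a_eq0).
Qed.

Hypothesis X_compact : compact [set: X].
Hypothesis phi_cont : forall i, continuous (phi i).

Lemma near_oscillation_le g : (0 < g)%R ->
  \forall cov \near @fine_covers R X,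
    finite_open_cover cov /\ oscillation_le cov g.
Proof.
have FF := fine_covers_proper X_compact.
move=> g0; have [d d0 dP] := uniform_modulus X_compact phi_cont g0.
have := near_fine_covers (X := X) d0; apply: filterS => cov [covP cov_d].
by split=> // A x y cA Ax Ay; exact/dP/(cov_d A).
Qed.

Lemma near_refines cov : finite_open_cover cov ->
  \forall V \near @fine_covers R X,
    forall A, V A -> exists2 U, cov U & A `<=` U.
Proof.
have FF := fine_covers_proper X_compact.
move=> covP; have [r r0 rP] := lebesgue_number X_compact covP.
have := near_fine_covers (X := X) r0; apply: filterS => V [_ V_r] A VA.
have [->|/set0P[x Ax]] := eqVneq A set0.
  by have [U cU _] := rP point; exists U.
by have [U cU xU] := rP x; exists U => // y Ay; exact/xU/ltW/(V_r A).
Qed.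

(** The limit is the supremum [L] of [cover_pressure cov - g] over the covers on
    whose members the potentials oscillate by at most [g].  By
    [cover_pressure_refine] every such value is eventually a lower bound, and
    [cover_pressure cov <= L + g] with [g] as small as desired for fine covers.
    *)
Lemma is_cvg_cover_pressure Z :
  cvg (cover_pressure f phi Z cov @[cov --> @fine_covers R X]).
Proof.
have FF := fine_covers_proper X_compact.
pose S := [set cp | finite_open_cover cp.1 /\
  (0 <= cp.2)%R /\ oscillation_le cp.1 cp.2].
pose L := ereal_sup ((fun cp => cover_pressure f phi Z cp.1 - cp.2%:E) @` S).
apply/cvg_ex; exists L; apply: cvge_sandwich.
  move=> a /ereal_sup_gt[_ [[cov g] /= [covP [g0 osc]] <-] aP].
  have := near_refines covP; apply: filterS => V Vcov.
  apply: lt_le_trans aP _; rewrite EFinN leeBlDr//.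
  exact: (cover_pressure_refine _ g0 osc Vcov).
move=> b Lb.
have [g g0 gb] : exists2 g : R, (0 < g)%R & L + g%:E < b.
  case: b L Lb => [b| |] [l| |]//.
  - rewrite lte_fin => lb; exists ((b - l) / 2)%R.
      by rewrite divr_gt0// subr_gt0.
    by rewrite -EFinD lte_fin; lra.
  - by move=> _; exists 1%R => //; rewrite ltNyr.
  - by move=> _; exists 1%R => //; rewrite -EFinD ltry.
  - by move=> _; exists 1%R.
have := near_oscillation_le g0; apply: filterS => cov [covP osc].
apply: le_lt_trans gb; rewrite -leeBlDr//; apply: ereal_sup_ubound.
by exists (cov, g) => //; split=> //; split=> //; exact: ltW.
Qed.

End pressure_theory.

(** * Local pressures *)

Section local_pressure_theory.
Context {R : realType} {X : pmetricType R} {m : nat}.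
Variables (mu : probability (borelType X) R).
Variables (f : 'I_m -> X -> X) (phi : 'I_m -> X -> R).
Hypothesis f_cont : forall i, continuous (f i).
Implicit Types (r c : R) (x : X).

Lemma le_local_term r r' x w : (r <= r')%R ->
  local_term mu f phi r x w <= local_term mu f phi r' x w.
Proof.
move=> rr'; apply: leeB => //.
rewrite lee_lne ?in_itv/= ?measure_ge0 ?leey//.
apply: le_measure; rewrite ?inE; try exact: measurable_bowen_ball.
exact: subset_bowen_ball.
Qed.

Lemma local_term_lt r x (w : seq 'I_m) c :
  local_term mu f phi r x w < c%:E ->
  mu (bowen_ball f w x r) <= (expR (c + birkhoff f phi w x))%:E.
Proof.
rewrite /local_term lteBlDr// -EFinD -lte_expeR lneK; first exact: ltW.
by rewrite in_itv/= measure_ge0 leey.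
Qed.

Lemma lt_local_term r x (w : seq 'I_m) c :
  c%:E < local_term mu f phi r x w ->
  (expR (c + birkhoff f phi w x))%:E <= mu (bowen_ball f w x r).
Proof.
rewrite /local_term lteBrDr// -EFinD -lte_expeR lneK; first exact: ltW.
by rewrite in_itv/= measure_ge0 leey.
Qed.

(** Shrinking [r] shrinks Bowen balls, so both local pressures are limits of
    functions of [r] that increase as [r] decreases to [0]. *)
Lemma nonincreasing_lim_at0 (h : R -> \bar R) :
  (forall r r', (r <= r')%R -> h r' <= h r) ->
  lim (h r @[r --> 0%R^'+]) = ereal_sup (h @` `]0%R, +oo[).
Proof.
move=> h_mono; apply: cvg_lim => //.
have := @nonincreasing_at_right_cvge _ h 0%R (BInfty R false).
apply => //; by move=> r r' _ _; exact: h_mono.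
Qed.

(** The maximum over words bounds [local_term] for every word at once, whence a
    uniform upper bound on the measures of all long Bowen balls at [x]. *)
Lemma lt_lower_local_pressure x c :
  c%:E < lower_local_pressure mu f phi x ->
  exists2 r, (0 < r)%R & exists N, forall w, (N <= size w)%N ->
    mu (bowen_ball f w x r) <=
    (expR (birkhoff f phi w x - c * (size w)%:R))%:E.
Proof.
rewrite /lower_local_pressure nonincreasing_lim_at0; last first.
  move=> r r' rr'; apply: le_limn_einf => n.
  rewrite EFinN !mulNe leeN2 lee_wpmul2l ?lee_fin//.
  by apply: le_bigmax2 => w _; exact: le_local_term.
move=> /ereal_sup_gt[_ [r /= + <-]]; rewrite in_itv/= andbT => r0.
move=> /lt_limn_einf[N NP]; exists r => //; exists (maxn N 1) => w.
rewrite geq_max => /andP[/NP + w1].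
rewrite EFinN mulNe lteNr lte_pdivrMl ?ltr0n// -EFinN -EFinM => cw.
rewrite addrC -mulNr (mulrC (- c)%R); apply: local_term_lt.
exact: le_lt_trans (le_bigmax _ _ (in_tuple w)) cw.
Qed.

(** Here the lower limit gives the bound for infinitely many lengths only, but
    the minimum gives it for every word of such a length; the covering argument
    needs this freedom to choose a word with a prescribed beginning. *)
Lemma upper_local_pressure_lt x c :
  upper_local_pressure mu f phi x < c%:E ->
  forall r, (0 < r)%R -> forall N, exists2 n, (N <= n)%N &
    forall w, size w = n ->
      (expR (birkhoff f phi w x - c * n%:R))%:E <= mu (bowen_ball f w x r).
Proof.
rewrite /upper_local_pressure nonincreasing_lim_at0; last first.
  move=> r r' rr'; apply: le_limn_einf => n.
  rewrite EFinN !mulNe leeN2 lee_wpmul2l ?lee_fin//.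
  by apply: le_bigmin2 => w _; exact: le_local_term.
move=> xc r r0 N; have : ereal_sup _ < _ := xc.
move=> /(le_lt_trans (ereal_sup_ubound _)) => /(_ _ (ex_intro2 _ _ r _ erefl)).
rewrite /= in_itv/= r0 => /(_ isT)/limn_einf_lt/(_ (maxn N 1))[n].
rewrite geq_max => /andP[Nn n1].
rewrite EFinN mulNe lteNl lte_pdivlMl ?ltr0n// -EFinN -EFinM => cw.
exists n => // w wn; rewrite addrC -mulNr (mulrC (- c)%R); apply: lt_local_term.
have wsz : size w == n by apply/eqP.
exact: lt_le_trans cw (bigmin_le _ (Tuple wsz) _).
Qed.

End local_pressure_theory.

(** * Lower bound: the mass distribution principle *)

Section lower_bound.
Context {R : realType} {X : pmetricType R} {m : nat}.
Variables (mu : probability (borelType X) R).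
Variables (f : 'I_m -> X -> X) (phi : 'I_m -> X -> R).
Hypothesis m_gt0 : (0 < m)%N.
Hypothesis f_cont : forall i, continuous (f i).

(** The mass distribution principle.  If [m(Z, a) = 0], strings of arbitrarily
    small total weight cover [Z].  Since the members of [cov] have diameter less
    than [r], each string set meeting [A] lies in a Bowen ball centred at one of
    its points in [A], whose measure is at most [exp a] times the weight of the
    string as soon as [a < c]. *)
Lemma negligible_of_pressure_m_eq0 (Z A : set X) (cov : set (set X))
    (r a c : R) (N : nat) :
  A `<=` Z ->
  (forall x w, A x -> (N <= size w)%N ->
    mu (bowen_ball f w x r) <=
      (expR (birkhoff f phi w x - c * (size w)%:R))%:E) ->
  (forall U x y, cov U -> U x -> U y -> (mdist x y < r)%R) ->
  pressure_m f phi Z a cov = 0 -> (a < c)%R ->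
  mu.-negligible (A : set (borelType X)).
Proof.
move=> AZ A_ball cov_r m_eq0 ac; apply: negligible_le_eps => e e0.
have w_size : size (nseq N (Ordinal m_gt0)) == N by rewrite size_nseq.
have Mw_eq0 := pressure_m_eq0_Mw m_gt0 (Tuple w_size) m_eq0.
have : pressure_Mw f phi Z a cov N (Tuple w_size) < (e / expR a)%:E.
  by rewrite Mw_eq0 lte_fin divr_gt0// expR_gt0.
move=> /pressure_Mw_lt[G [Gc GP GZ] G_lt].
have /choice[pt ptP] : forall p : seq (set X) * seq 'I_m, exists x,
    (string_set f p.1 p.2 `&` A) !=set0 -> (string_set f p.1 p.2 `&` A) x.
  move=> p; have [[x px]|np] := pselect ((string_set f p.1 p.2 `&` A) !=set0).
    by exists x.
  by exists point.
(* The factor [expR a] in the target of the sum accounts for a string being one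
   longer than its word. *)
pose G0 := G `&` [set p | (string_set f p.1 p.2 `&` A) !=set0].
have G0c : countable G0.
  by apply: sub_countable Gc; apply: subset_card_le => ? [].
pose B p : set (borelType X) := bowen_ball f p.2 (pt p) r.
have mB p : measurable (B p) by exact: measurable_bowen_ball.
have [mBU mu_BU] := measure_countable_bigcup_le mu G0c mB.
exists (\bigcup_(p in G0) B p); split => //.
- move=> x Ax; have [p Gp px] := GZ _ (AZ _ Ax).
  have pA : (string_set f p.1 p.2 `&` A) !=set0 by exists x.
  exists p => //; apply/bowen_ballP => j jp; apply/ltW.
  have [ptp _] := ptP _ pA; have [pcov _ psize _] := GP _ Gp.
  apply: (cov_r (nth set0 p.1 j)); [|exact: ptp|exact: px].
  by apply: pcov; rewrite mem_nth// psize ltnS.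
- apply: le_trans mu_BU _.
  apply: (@le_trans _ _
    (\esum_(p in G0) ((expR a)%:E * string_weight f phi a p))).
    apply: le_esum => p [Gp pA]; have [pcov Np psize _] := GP _ Gp.
    have [ptp Apt] := ptP _ pA.
    apply: le_trans (A_ball _ p.2 Apt _) _; first by rewrite -ltnS -psize.
    rewrite -[(expR a)%:E]/(expeR a%:E) -expeRD -[X in X <= _]/(expeR _%:E).
    rewrite lee_expeR addeA -EFinD.
    have : (birkhoff f phi p.2 (pt p))%:E <= birkhoff_sup f phi p.
      by apply: ereal_sup_ubound; exists (pt p).
    move=> /(leeD2l (a - a * (size p.1)%:R)%:E); apply: le_trans.
    rewrite -EFinD lee_fin psize -natr1.
    by have : (0 <= (size p.2)%:R :> R)%R by []; nra.
  apply: le_trans (esumZl_le _ _ _) _ => [|p|]; first exact: expR_ge0.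
    exact: expeR_ge0.
  apply: (@le_trans _ _ ((expR a)%:E * (e / expR a)%:E)).
    apply: lee_wpmul2l; first by rewrite lee_fin expR_ge0.
    by apply: le_trans (ltW G_lt); apply: esum_subset => ? [].
  by rewrite -EFinM mulrCA divff ?mulr1// gt_eqF// expR_gt0.
Qed.

(** The radius and the length from which the bound of
    [lt_lower_local_pressure] holds depend on [x].  Countably many choices
    exhaust [Z], and a set of positive measure is not a countable union of
    negligible sets.  Working with negligible sets avoids proving that the
    pieces are measurable. *)
Lemma exists_uniform_nonnegligible (Z : set (borelType X)) (c : R) :
  measurable Z -> 0 < mu Z ->
  (forall x, Z x -> c%:E < lower_local_pressure mu f phi x) ->
  exists (A : set X) (r : R) (N : nat), [/\ A `<=` Z, (0 < r)%R,
    ~ mu.-negligible (A : set (borelType X)) &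
    forall x w, A x -> (N <= size w)%N ->
      mu (bowen_ball f w x r) <=
        (expR (birkhoff f phi w x - c * (size w)%:R))%:E].
Proof.
move=> mZ muZ Z_lower; apply: contrapT => no_A.
pose A k := [set x | Z x /\ forall w, (k <= size w)%N ->
  mu (bowen_ball f w x k.+1%:R^-1) <=
    (expR (birkhoff f phi w x - c * (size w)%:R))%:E].
have A_negl k : mu.-negligible (A k : set (borelType X)).
  apply: contrapT => nA; apply: no_A; exists (A k), k.+1%:R^-1%R, k.
  split=> //; first by move=> x [].
  by move=> x w [_]; exact.
have /measure_negligible : mu.-negligible Z.
  apply: negligibleS (negligible_bigcup A_negl) => x Zx.
  have [r r0 [N NP]] := lt_lower_local_pressure f_cont (Z_lower _ Zx).
  pose k := maxn N (Num.Def.archi_bound r^-1).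
  exists k => //; split=> // w; rewrite geq_max => /andP[Nw _].
  apply: le_trans (NP _ Nw).
  apply: le_measure; rewrite ?inE; try exact: measurable_bowen_ball.
  apply: subset_bowen_ball.
  exact: invr_archi_bound_le (leq_maxr N _).
by move=> /(_ mZ) Z0; move: muZ; rewrite Z0 ltxx.
Qed.

End lower_bound.

(** * Upper bound: maximal disjoint families of Bowen balls *)

Section upper_bound.
Context {R : realType} {X : pmetricType R} {m : nat}.
Variables (mu : probability (borelType X) R).
Variables (f : 'I_m -> X -> X) (phi : 'I_m -> X -> R).
Hypothesis m_gt0 : (0 < m)%N.
Hypothesis f_cont : forall i, continuous (f i).
Hypothesis X_compact : compact [set: X].

(** By maximality the [r]-ball of any point of [A] meets one of the chosen
    [r]-balls, so doubling the radius covers [A]. *)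
Lemma maximal_disjoint_bowen_cover (A D : set X) w (r : R) : (0 <= r)%R ->
  maximal_disjoint_subcollection (fun x => bowen_ball f w x r) D A ->
  A `<=` \bigcup_(x in D) bowen_ball f w x (r + r).
Proof.
move=> r0 [DA tD Dmax] z Az.
suff [x Dx [y [/bowen_ballP xy /bowen_ballP zy]]] : exists2 x, D x &
    (bowen_ball f w x r `&` bowen_ball f w z r) !=set0.
  exists x => //; apply/bowen_ballP => j jw.
  apply: le_trans (metric_triangle _ (itinerary f w j y) _) _.
  by rewrite lerD ?xy// metric_sym zy.
apply: contrapT => noD.
have nDz : ~ D z.
  move=> Dz; apply: noD; exists z => //; exists z.
  by split; exact: bowen_ball_center.
apply: (Dmax (z |` D)); first split.
- by move=> x Dx; right.
- by move=> /(_ z (or_introl erefl)).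
- by move=> x [->|/DA].
- move=> i j [->|Di] [->|Dj] // ij.
  + by exfalso; apply: noD; exists j => //; rewrite setIC.
  + by exfalso; apply: noD; exists i.
  + exact: tD.
Qed.

(** For [n = N + k] take a single word [v k] of length [n] that starts with [w],
    and the points [good k] of [Z] at which [v k] satisfies the lower bound on
    the measure of its Bowen ball.  Every point of [Z] is good for some [k].  A
    maximal disjoint family of [r]-balls centred in [good k] has total measure
    at most [1], and the balls of radius [2 * r], the Lebesgue number, are
    contained in string sets.  With [a = c + 2 * e] the corresponding strings
    have total weight at most [exp (- a) * exp (- e * n)]: one [e] absorbs the
    oscillation of the Birkhoff sums, the other makes the sum over [n >= N] a
    geometric tail. *)
Lemma pressure_Mw_le_geometric (Z : set X) (cov : set (set X)) (c e : R)
    (N : nat) (w : seq 'I_m) :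
  finite_open_cover cov -> oscillation_le phi cov e -> (0 < e)%R ->
  (forall x, Z x -> forall r, (0 < r)%R -> forall k, exists2 n, (k <= n)%N &
    forall v, size v = n -> (expR (birkhoff f phi v x - c * n%:R))%:E <=
      mu (bowen_ball f v x r)) ->
  size w = N ->
  pressure_Mw f phi Z (c + e + e) cov N w <=
    (expR (- (c + e + e)) / (1 - expR (- e)) * expR (- e) ^+ N)%:E.
Proof.
move=> covP osc e0 Z_upper w_size.
set a := (c + e + e)%R; set q := expR (- e).
have [rho rho0 rhoP] := lebesgue_number X_compact covP.
have /choice[h hP] : forall x, exists U,
    cov U /\ forall y, (mdist x y <= rho)%R -> U y.
  by move=> x; have [U cU xU] := rhoP x; exists U.
pose r := (rho / 2)%R; have r0 : (0 < r)%R by rewrite divr_gt0.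
(* Any continuation of [w] would do. *)
pose v k := w ++ nseq k (Ordinal m_gt0).
have v_size k : size (v k) = (N + k)%N by rewrite size_cat size_nseq w_size.
pose good k := [set x | Z x /\
  (expR (birkhoff f phi (v k) x - c * (N + k)%:R))%:E <=
    mu (bowen_ball f (v k) x r)].
have /choice[D DP] : forall k, exists D,
    maximal_disjoint_subcollection (fun x => bowen_ball f (v k) x r) D (good k).
  move=> k; pose F x := bowen_ball f (v k) x r.
  by have [D DP] := ex_maximal_disjoint_subcollection F (good k); exists D.
have D_sum k : \esum_(x in D k) mu (bowen_ball f (v k) x r) <= 1.
  apply: esum_disjoint_le1; last by have [] := DP k.
  by move=> x; exact: measurable_bowen_ball.
have D_countable k : countable (D k).
  apply: (@countable_esum_gt0 R _ _ (fun x => mu (bowen_ball f (v k) x r))).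
    move=> x Dx; have [/(_ _ Dx)[_] + _ _] := DP k; apply: lt_le_trans.
    by rewrite lte_fin expR_gt0.
  by apply: le_lt_trans (D_sum k) _; rewrite ltry.
pose U k x := [seq h (itinerary f (v k) j x) | j <- iota 0 (N + k).+1].
have U_size k x : size (U k x) = (N + k).+1 by rewrite size_map size_iota.
have U_nth k x j : (j <= N + k)%N ->
    nth set0 (U k x) j = h (itinerary f (v k) j x).
  by move=> jk; rewrite (nth_map 0%N) ?size_iota// nth_iota.
have U_cov k x A : A \in U k x -> cov A.
  by move=> /mapP[j _ ->]; exact: (hP _).1.
have ball_U k x : bowen_ball f (v k) x (r + r) `<=` string_set f (U k x) (v k).
  move=> y /bowen_ballP xy j jk; rewrite U_nth -?v_size//.
  by apply: (hP _).2; apply: le_trans (xy _ jk) _; rewrite -splitr.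
pose g (kx : nat * X) := (U kx.1 kx.2, v kx.1).
have weight_le k x : good k x -> string_weight f phi a (g (k, x)) <=
    (expR (- a) * q ^+ (N + k))%:E * mu (bowen_ball f (v k) x r).
  move=> [_ x_good].
  have sup_le : birkhoff_sup f phi (g (k, x)) <=
      (birkhoff f phi (v k) x + e * (N + k)%:R)%:E.
    apply: ge_ereal_sup => _ [y xy <-]; rewrite lee_fin -v_size.
    apply: (birkhoff_string_le osc (U_cov k x)) xy _.
      by rewrite U_size v_size.
    by apply: ball_U; apply: bowen_ball_center; rewrite addr_ge0// ltW.
  apply: (@le_trans _ _ ((expR (- a) * q ^+ (N + k))%:E *
      (expR (birkhoff f phi (v k) x - c * (N + k)%:R))%:E)); last first.
    apply: lee_wpmul2l => //.
    by rewrite lee_fin mulr_ge0 ?exprn_ge0 ?expR_ge0.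
  rewrite -EFinM -expRM_natl -!expRD -[X in _ <= X]/(expeR _%:E) lee_expeR.
  apply: le_trans (leeD2l _ sup_le) _.
  rewrite -EFinD lee_fin U_size -natr1 /a; nra.
have adm : admissible f cov Z w N (g @` ([set: nat] `*`` D)).
  split.
  - have -> : g @` ([set: nat] `*`` D) =
        \bigcup_(k in [set: nat]) (fun x => g (k, x)) @` D k.
      apply/seteqP; split=> [_ [[k x] [_ /= Dx] <-]|_ [k _ [x Dx <-]]].
        by exists k => //; exists x.
      by exists (k, x).
    apply: bigcup_countable => // k _.
    exact: sub_countable (card_image_le _ _) (D_countable k).
  - move=> _ [[k x] _ <-].
    split; [exact: U_cov|rewrite U_size|rewrite U_size v_size|] => //.
      by rewrite ltnS leq_addr.
    by rewrite suffix_rev prefix_prefix.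
  - move=> z Zz; have [n Nn zn] := Z_upper _ Zz _ r0 N.
    have zgood : good (n - N)%N z.
      by split=> //; rewrite subnKC//; apply: zn; rewrite v_size subnKC.
    have [x Dx xz] := maximal_disjoint_bowen_cover (ltW r0) (DP _) zgood.
    by exists (g ((n - N)%N, x)); [exists ((n - N)%N, x)|exact: ball_U].
have q01 : (0 < q < 1)%R by rewrite expR_gt0 expR_lt1 oppr_lt0.
have /andP[q0 q1] := q01.
apply: le_trans (pressure_Mw_le_esum _ _ adm) _.
(* Distinct centres may carry the same string, so [g] need not be injective. *)
apply: le_trans (esum_image_le _ _ _) _.
rewrite -(@esum_esum _ _ _ [set: nat] D
  (fun k x => string_weight f phi a (g (k, x)))); last first.
  by move=> k x _ _; exact: expeR_ge0.
apply: (@le_trans _ _ (\esum_(k in [set: nat])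
    (expR (- a) * q ^+ N * q ^+ k)%:E)).
  apply: le_esum => k _; rewrite -mulrA -exprD.
  have C0 : (0 <= expR (- a) * q ^+ (N + k))%R.
    by rewrite mulr_ge0 ?expR_ge0// exprn_ge0// ltW.
  apply: (@le_trans _ _ (\esum_(x in D k)
    ((expR (- a) * q ^+ (N + k))%:E * mu (bowen_ball f (v k) x r)))).
    apply: le_esum => x Dx; apply: weight_le.
    by have [+ _ _] := DP k; exact.
  apply: le_trans (esumZl_le _ C0 _) _; first by move=> x; exact: measure_ge0.
  by rewrite -[leRHS]mule1; apply: lee_wpmul2l; rewrite ?lee_fin.
rewrite mulrAC; apply: esum_geometric_le => //.
by rewrite mulr_ge0 ?expR_ge0// exprn_ge0// ltW.
Qed.

Lemma cover_pressure_le (Z : set X) (cov : set (set X)) (c e : R) :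
  finite_open_cover cov -> oscillation_le phi cov e -> (0 < e)%R ->
  (forall x, Z x -> upper_local_pressure mu f phi x < c%:E) ->
  cover_pressure f phi Z cov <= (c + e + e)%:E.
Proof.
move=> covP osc e0 Z_upper; apply: ereal_inf_lbound.
exists (c + e + e)%R => //=.
have q1 : (expR (- e) < 1)%R by rewrite expR_lt1 oppr_lt0.
apply: (@pressure_m_eq0 _ _ _ _ _ m_gt0 _ _ _
  (expR (- (c + e + e)) / (1 - expR (- e))) (expR (- e))).
- by rewrite divr_ge0 ?expR_ge0// subr_ge0 ltW.
- by rewrite expR_ge0.
- move=> N w; apply: pressure_Mw_le_geometric => //; last exact: size_tuple.
  by move=> x Zx; apply: upper_local_pressure_lt => //; exact: Z_upper.
Qed.

End upper_bound.

Theorem theorem2p2 (R : realType) (X : pmetricType R) (m : nat)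
    (f : 'I_m -> X -> X) (phi : 'I_m -> X -> R)
    (mu : probability (borelType X) R) (Z : set (borelType X)) (s : R)
    (m_gt0 : (0 < m)%N)
    (X_compact : compact [set: X])
    (f_cont : forall i, continuous (f i))
    (phi_cont : forall i, continuous (phi i))
    (Z_borel : measurable Z)
    (s_gt0 : (0 < s)%R) :
  ((forall x, Z x -> s%:E <= lower_local_pressure mu f phi x) ->
     0 < mu Z -> s%:E <= top_pressure f phi Z) /\
  ((forall x, Z x -> upper_local_pressure mu f phi x <= s%:E) ->
     top_pressure f phi Z <= s%:E).
Proof.
have FF := fine_covers_proper X_compact.
have P_cvg := @is_cvg_cover_pressure R X m f phi m_gt0 X_compact phi_cont Z.
split=> [Z_lower muZ|Z_upper].
  apply/lee_subgt0Pr => e e0; rewrite -EFinB.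
  have Z_lt x : Z x -> (s - e)%:E < lower_local_pressure mu f phi x.
    by move=> /Z_lower; apply: lt_le_trans; rewrite lte_fin ltrBlDr ltrDl.
  have [A [r [N [AZ r0 nA A_ball]]]] :=
    exists_uniform_nonnegligible f_cont Z_borel muZ Z_lt.
  apply: lime_ge => //; have := near_fine_covers (X := X) r0.
  apply: filterS => cov [covP cov_r]; apply: le_ereal_inf_tmp => _ [a a_eq0 <-].
  rewrite lee_fin leNgt; apply/negP => a_lt; apply: nA.
  exact: (negligible_of_pressure_m_eq0 m_gt0 f_cont AZ A_ball cov_r a_eq0 a_lt).
apply/lee_addgt0Pr => e e0; rewrite -EFinD.
have e3 : (0 < e / 3)%R by rewrite divr_gt0.
apply: lime_le => //.
have := near_oscillation_le X_compact phi_cont e3; apply: filterS.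
move=> cov [covP osc].
rewrite (_ : s + e = s + e / 3 + e / 3 + e / 3)%R; last lra.
apply: (cover_pressure_le (mu := mu)) => // x /Z_upper.
by move=> /le_lt_trans; apply; rewrite lte_fin ltrDl.
Qed.
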